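(* Let $A\in\mathbb{R}^{n\times m}$ be the incidence matrix of a simple connected graph with $n$ nodes and $m$ edges, each edge being given an arbitrary reference direction. Let $1\le r<n$, let $A_{\mathbf 1}\in\mathbb{R}^{r\times m}$ be the submatrix of $A$ formed by its first $r$ rows and $A_{\mathbf 2}\in\mathbb{R}^{(n-r)\times m}$ the submatrix formed by its last $n-r$ rows, and set $\mathbb{L}_{ij}=A_{\mathbf i}A_{\mathbf j}^{\mathsf T}$ for $i,j\in\{1,2\}$. Consider the differential-algebraic equation (DAE) $$y'=-\mathbb{L}_{11}y-\mathbb{L}_{12}z,\qquad 0=\mathbb{L}_{21}y+\mathbb{L}_{22}z,$$ with $y=(y_1,\dots,y_r)\in\mathbb{R}^r$ and $z=(z_1,\dots,z_{n-r})\in\mathbb{R}^{n-r}$. Then the following hold. (a) The constraint $0=\mathbb{L}_{21}y+\mathbb{L}_{22}z$ specifies an $r$-dimensional solution space of the DAE in $\mathbb{R}^n$. The intersections of this space with the hyperplanes $\sum_{i=1}^r y_i=k$, $k\in\mathbb{R}$, are transversal and define a foliation of the dynamics by a family of $(r-1)$-dimensional invariant (affine) spaces. (b) All equilibrium points of the DAE are located in the line $y_1=y_2=\dots=y_r=z_1=\dots=z_{n-r}$, which is transversal to the invariant spaces in (a) if $r\ge 2$. (c) The trajectory $(y(t),z(t))$ emanating from a given consistent initial value $(y(0),z(0))$ converges exponentially (as $t\to\infty$) to the equilibrium $$y_i=z_j=\frac{y_1(0)+\dots+y_r(0)}{r},\qquad i=1,\dots,r,\ j=1,\dots,n-r.$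$
   Context: A graph is simple if it has neither parallel edges nor self-loops. With a reference direction given to each edge, the incidence matrix $A=(a_{ij})\in\mathbb{R}^{n\times m}$ has $a_{ij}=1$ if edge $j$ leaves node $i$, $a_{ij}=-1$ if edge $j$ enters node $i$, and $a_{ij}=0$ if edge $j$ is not incident with node $i$. A consistent initial value of the DAE is a value $(y(0),z(0))$ satisfying the constraint $0=\mathbb{L}_{21}y(0)+\mathbb{L}_{22}z(0)$. That the constraint specifies a solution space means that the linear space defined by it is filled by solutions of the DAE. An equilibrium is a constant solution, i.e. a point $(y,z)$ with $\mathbb{L}_{11}y+\mathbb{L}_{12}z=0$ and $\mathbb{L}_{21}y+\mathbb{L}_{22}z=0$. Invariance of a space means that solutions of the DAE starting in it remain in it. The hyperplanes $\sum_{i=1}^r y_i=k$ are understood in the space $\mathbb{R}^n$ of the variables $(y,z)$. In (b), transversality of the line and an invariant space is understood within the $r$-dimensional solution space. *)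

(* Defs.v *)
From HB Require Import structures.
From mathcomp Require Import all_boot all_order all_algebra.
From mathcomp Require Import all_classical all_reals all_analysis.

Set Implicit Arguments.
Unset Strict Implicit.
Unset Printing Implicit Defensive.

Import Order.TTheory GRing.Theory Num.Theory.
Import numFieldNormedType.Exports.

Local Open Scope classical_set_scope.
Local Open Scope ring_scope.

(* A graph on the nodes 'I_n with edges labelled by 'I_m, edge j being given
   the reference direction from [tail j] to [head j]. *)
Record directed_graph (n m : nat) := DirectedGraph {
  tail : 'I_m -> 'I_n;
  head : 'I_m -> 'I_n
}.

Definition same_ends (n m : nat) (G : directed_graph n m) (j k : 'I_m) : Prop :=
  (tail G j = tail G k /\ head G j = head G k) \/
  (tail G j = head G k /\ head G j = tail G k).

Definition simple_graph (n m : nat) (G : directed_graph n m) : Prop :=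
  (forall j, tail G j <> head G j) /\
  (forall j k, same_ends G j k -> j = k).

Definition adjacent (n m : nat) (G : directed_graph n m) : rel 'I_n :=
  fun u v => [exists j, ((tail G j == u) && (head G j == v)) ||
                        ((tail G j == v) && (head G j == u))].

Definition connected_graph (n m : nat) (G : directed_graph n m) : Prop :=
  forall u v, connect (adjacent G) u v.

(* Only meaningful in the absence of self-loops. *)
Definition incidence_mx (R : realType) (n m : nat) (G : directed_graph n m) :
    'M[R]_(n, m) :=
  \matrix_(i, j) (if tail G j == i then 1 else if head G j == i then -1 else 0).

Section DAE.
Variables (R : realType) (r s m : nat) (A : 'M[R]_(r + s, m)).

Definition L11 : 'M[R]_(r, r) := usubmx A *m (usubmx A)^T.
Definition L12 : 'M[R]_(r, s) := usubmx A *m (dsubmx A)^T.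
Definition L21 : 'M[R]_(s, r) := dsubmx A *m (usubmx A)^T.
Definition L22 : 'M[R]_(s, s) := dsubmx A *m (dsubmx A)^T.

(* A point x of R^(r+s) is the stacked vector (y, z). *)
Definition constraint_set : set 'cV[R]_(r + s) :=
  [set x | 0 = L21 *m usubmx x + L22 *m dsubmx x].

(* Derivative relative to J: two-sided at the interior points of J, one-sided
   at an end point belonging to J. *)
Definition has_derivative_in (J : interval R) (p : nat) (f : R -> 'cV[R]_p)
    (t : R) (v : 'cV[R]_p) : Prop :=
  (u - t)^-1 *: (f u - f t) @[u --> within [set` J] t^'] --> v.

(* z is not required to be regular: the constraint determines it from y. *)
Definition dae_solution (J : interval R) (x : R -> 'cV[R]_(r + s)) : Prop :=
  forall t, t \in J ->
    has_derivative_in J (fun u => usubmx (x u)) t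
      (- (L11 *m usubmx (x t)) - L12 *m dsubmx (x t)) /\
    0 = L21 *m usubmx (x t) + L22 *m dsubmx (x t).

Definition filled_by_solutions (S : set 'cV[R]_(r + s)) : Prop :=
  forall p, S p <-> exists x, dae_solution `]-oo, +oo[ x /\ x 0 = p.

Definition invariant_set (S : set 'cV[R]_(r + s)) : Prop :=
  forall (J : interval R) x, dae_solution J x ->
  forall t0 t, t0 \in J -> t \in J -> t0 <= t -> S (x t0) -> S (x t).

Definition equilibrium (x : 'cV[R]_(r + s)) : Prop :=
  L11 *m usubmx x + L12 *m dsubmx x = 0 /\
  L21 *m usubmx x + L22 *m dsubmx x = 0.

(* x is the trajectory emanating from p at time 0: every solution through p,
   on whatever interval, agrees with x at nonnegative times. *)
Definition trajectory_from (p : 'cV[R]_(r + s)) (x : R -> 'cV[R]_(r + s)) :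
    Prop :=
  [/\ dae_solution `[0, +oo[ x, x 0 = p &
      forall (J : interval R) w, dae_solution J w -> 0 \in J -> w 0 = p ->
        forall t, t \in J -> 0 <= t -> w t = x t].

End DAE.

Definition sum_hyperplane (R : realType) (r s : nat) (k : R) :
    set 'cV[R]_(r + s) :=
  [set x | \sum_(i < r) usubmx x i 0 = k].

Definition diagonal_line (R : realType) (n : nat) : set 'cV[R]_n :=
  [set x | forall i j, x i 0 = x j 0].

Definition converges_exponentially (R : realType) (n : nat)
    (x : R -> 'cV[R]_n) (l : 'cV[R]_n) : Prop :=
  exists M a : R, 0 < a /\
    forall t, 0 <= t -> `|x t - l| <= M * expR (- (a * t)).

Section Affine.
Variables (R : realType) (V : vectType R).

Definition linear_space_of_dim (d : nat) (S : set V) : Prop :=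
  exists U : {vspace V}, S = [set x | x \in U] /\ \dim U = d.

Definition affine_space (S : set V) (U : {vspace V}) : Prop :=
  exists2 p, S p & S = [set p + u | u in [set u | u \in U]].

(* Affine subspaces of an affine space W meet transversally in W when their
   directions (tangent spaces) span that of W. *)
Definition transversal_in (W S T : set V) : Prop :=
  exists Wd Sd Td : {vspace V},
    [/\ affine_space W Wd, affine_space S Sd & affine_space T Td] /\
    [/\ S `<=` W, T `<=` W & (Sd + Td)%VS = Wd].

(* S is partitioned by the leaves F k, which are parallel d-dimensional
   affine spaces. *)
Definition affine_foliation (d : nat) (I : Type) (S : set V) (F : I -> set V) :
    Prop :=
  exists D : {vspace V},
    [/\ \dim D = d, forall k, affine_space (F k) D,
        \bigcup_k F k = S & trivIset setT F].

End Affine.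

(* Main.v *)
Require Import Defs.
From mathcomp Require Import all_boot all_order all_algebra.
From mathcomp Require Import all_classical all_reals all_analysis.
From mathcomp Require Import complex ring.
Import Order.TTheory GRing.Theory Num.Theory.
Import numFieldNormedType.Exports.
Local Open Scope classical_set_scope.
Local Open Scope ring_scope.
Set Implicit Arguments.
Unset Strict Implicit.
Unset Printing Implicit Defensive.

(** The graph enters only through the kernel of [A^T]: [A^T x] lists the
differences of [x] along the edges, so for a connected graph its kernel
consists of the constant vectors ([incidence_tr_const],
[incidence_tr_kernel]).

Since [0 < r], no nonzero vector supported on the last [s] nodes is constant,
so [L22] is invertible ([L22_unit]).  The constraint then reads
[z = - L22^-1 L21 y]: the constraint set is the graph of a linear map of [y],
the image of [lift_mx], and on it the equation becomes [y' = - S y] with the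
Schur complement [S = L11 - L12 L22^-1 L21].  Writing [E] for [lift_mx], one
finds [S = (E^T A) (E^T A)^T] ([reduced_laplacianE]).  Therefore [S] is
symmetric and positive semidefinite, its kernel is the line of constant vectors
(they satisfy the constraint), and by symmetry the entries of every [S y] sum
to zero.  These properties of [S] are used as follows:

- positivity makes the squared distance of two solutions nonincreasing, which
  gives uniqueness forward in time ([linear_flow_unique]), and it excludes
  negative eigenvalues;
- vanishing coordinate sums of [S y] keep [y_1 + ... + y_r] constant along solutions
  ([dae_sum_constant]), which is the invariance in (a);
- symmetry lets the initial value be written as a sum of eigenvectors [w_i]
  with real eigenvalues [lam_i] ([symmetric_eigenvector_sum]), so that
  [\sum_i exp(- lam_i t) w_i] is a solution on the whole line.

In that sum the modes with positive [lam_i] decay at least like [exp (- a t)],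
where [a] is a positive lower bound of these eigenvalues, and have coordinate sum zero.  The
modes with [lam_i = 0] add up to a vector in the kernel of [S], a constant
vector with the same coordinate sum as the initial value; it is the mean of
[y(0)] ([null_modes_sum], [modal_flow_decay]).  This is (c).

Transversality in (a) and (b) comes from one remark: the vector of ones lies in
the constraint space and has nonzero coordinate sum over the first [r] nodes,
so subtracting a suitable multiple of it brings any vector into the kernel of
that sum ([sub_mean_sum]). *)

(** * Real symmetric matrices *)

(** The spectral theorem over the complex numbers diagonalizes [S] with real
eigenvalues.  As [S], [y] and the eigenvalues are real, taking real parts in
the complex eigenvector expansion of [y] yields a real one.  This form, a sum of
possibly zero vectors scaled by [S], is what solving [y' = - S y] mode by mode
requires. *)
Lemma symmetric_eigenvector_sum (R : rcfType) n (S : 'M[R]_n) (y : 'cV[R]_n) :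
  S^T = S ->
  exists (lam : 'I_n -> R) (w : 'I_n -> 'cV[R]_n),
    (forall i, S *m w i = lam i *: w i) /\ y = \sum_i w i.
Proof.
move=> symS; pose toC := real_complex R.
pose SC := map_mx toC S.
have hermS : SC \is hermsymmx.
  apply: realsym_hermsym.
    by apply/is_hermitianmxP; rewrite expr0 scale1r map_mx_id // map_trmx symS.
  by apply/mxOverP => i j; rewrite mxE complex_real.
have normS := hermitian_normalmx hermS.
have [P [d [Pu dR SE]]] : exists (P : 'M[R[i]%C]_n) (d : 'rV[R[i]%C]_n),
    [/\ P \in unitmx, d \is a mxOver Num.real & SC = invmx P *m diag_mx d *m P].
  exists (spectralmx SC), (spectral_diag SC); split.
  - exact: spectral_unit.
  - exact: hermitian_spectral_diag_real.
  - exact/orthomx_spectralP.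
pose Q := invmx P; pose c := P *m map_mx toC y.
have eigQ : SC *m Q = Q *m diag_mx d by rewrite SE mulmxK.
(* [Q *m c = y] expands y in the basis of eigenvectors given by the columns of
   Q; the witnesses are the real parts of the terms of this expansion. *)
exists (fun i => complex.Re (d 0 i)), (fun i => \col_k complex.Re (Q k i * c i 0)).
have reM (a : R) (z : R[i]%C) : complex.Re (toC a * z) = a * complex.Re z.
  by case: z => b1 b2 /=; rewrite mul0r subr0.
have reS (F : 'I_n -> R[i]%C) : complex.Re (\sum_k F k) = \sum_k complex.Re (F k).
  by apply: (big_morph (@complex.Re R)) => // -[a b] [a' b'].
split=> [i|].
  apply/colP => j; rewrite !mxE.
  under eq_bigr do rewrite mxE -reM.
  rewrite -reS -reM /toC RRe_real; last exact: (mxOverP dR).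
  congr complex.Re; move/matrixP/(_ j i): eigQ; rewrite mul_mx_diag !mxE => eigji.
  rewrite [RHS]mulrA [d 0 i * _]mulrC -eigji mulr_suml.
  by apply: eq_bigr => k _; rewrite mxE mulrA.
apply/colP => j; rewrite summxE.
under eq_bigr do rewrite mxE.
rewrite -reS.
have /colP/(_ j) : Q *m c = map_mx toC y by rewrite mulKmx.
by rewrite !mxE => ->.
Qed.

Lemma dot_ge0 (R : realFieldType) n (v : 'cV[R]_n) : 0 <= (v^T *m v) 0 0.
Proof. by rewrite mxE sumr_ge0 // => i _; rewrite mxE -expr2 sqr_ge0. Qed.

Lemma dot_eq0 (R : realFieldType) n (v : 'cV[R]_n) :
  (v^T *m v) 0 0 = 0 -> v = 0.
Proof.
rewrite mxE => /eqP; rewrite psumr_eq0 => [/allP v0|i _]; last first.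
  by rewrite mxE -expr2 sqr_ge0.
apply/colP => i; have := v0 i (mem_index_enum i).
by rewrite !mxE mulf_eq0 orbb => /eqP.
Qed.

(** [|B^T x|^2 = x^T B B^T x]. *)
Lemma gram_kernel (R : realFieldType) n m (B : 'M[R]_(n, m)) (x : 'cV[R]_n) :
  B *m B^T *m x = 0 -> B^T *m x = 0.
Proof.
move=> BBx; apply: dot_eq0.
by rewrite trmx_mul trmxK -mulmxA (mulmxA B) BBx mulmx0 mxE.
Qed.

(** * Incidence matrices *)

Section Graph.
Variables (R : realType) (n m : nat) (G : directed_graph n m).
Hypothesis loopless : forall j, tail G j <> Defs.head G j.

Lemma incidence_tr_mulmx (x : 'cV[R]_n) j :
  ((incidence_mx R G)^T *m x) j 0 = x (tail G j) 0 - x (Defs.head G j) 0.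
Proof.
have ht : Defs.head G j != tail G j by apply/eqP => /esym/loopless.
rewrite mxE (bigD1 (tail G j)) //= (bigD1 (Defs.head G j)) //= !mxE !eqxx.
rewrite [tail G j == Defs.head G j]eq_sym (negPf ht) mul1r mulN1r big1 ?addr0 //.
by move=> i /andP[it ih]; rewrite !mxE eq_sym (negPf it) eq_sym (negPf ih) mul0r.
Qed.

Lemma incidence_tr_const (c : R) :
  (incidence_mx R G)^T *m const_mx c = 0 :> 'cV_m.
Proof. by apply/colP => j; rewrite incidence_tr_mulmx !mxE subrr. Qed.

(** [A^T x = 0] says that [x] takes equal values at the ends of each edge, hence
along every path. *)
Lemma incidence_tr_kernel (x : 'cV[R]_n) : connected_graph G ->
  (incidence_mx R G)^T *m x = 0 -> diagonal_line x.
Proof.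
move=> conn Ax u v; case/connectP: (conn u v) => p + ->.
elim: p u => [//|w p IHp] u /= /andP[/existsP[j uw] /IHp <-].
have /colP/(_ j) := Ax; rewrite incidence_tr_mulmx mxE => /eqP.
by rewrite subr_eq0 => /eqP; case/orP: uw => /andP[/eqP -> /eqP ->].
Qed.

End Graph.

(** * Elimination of the constrained variables *)

Section Reduction.
Variables (R : realType) (r s m : nat) (A : 'M[R]_(r + s, m)).
Hypothesis r_gt0 : (0 < r)%N.
Hypothesis A_const : forall c : R, A^T *m const_mx c = 0 :> 'cV_m.
Hypothesis A_kernel : forall x : 'cV[R]_(r + s), A^T *m x = 0 -> diagonal_line x.

(** [z = elim_mx *m y] solves the constraint for [z]; [lift_mx] sends [y] to the
point [(y, z)] of the constraint set. *)
Definition elim_mx : 'M[R]_(s, r) := - (invmx (L22 A) *m L21 A).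
Definition lift_mx : 'M[R]_(r + s, r) := col_mx 1%:M elim_mx.

(** The Schur complement of [L22] in the Laplacian [A *m A^T]. *)
Definition reduced_laplacian : 'M[R]_r := L11 A + L12 A *m elim_mx.
Local Notation K := elim_mx.
Local Notation E := lift_mx.
Local Notation S := reduced_laplacian.

Lemma mul_trmx_usub_dsub (x : 'cV[R]_(r + s)) :
  A^T *m x = (usubmx A)^T *m usubmx x + (dsubmx A)^T *m dsubmx x.
Proof.
by rewrite -{1}(vsubmxK A) -{1}(vsubmxK x) tr_col_mx mul_row_col.
Qed.

Lemma mul_upper_laplacian (x : 'cV[R]_(r + s)) :
  L11 A *m usubmx x + L12 A *m dsubmx x = usubmx A *m (A^T *m x).
Proof. by rewrite mul_trmx_usub_dsub mulmxDr !mulmxA. Qed.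

Lemma mul_lower_laplacian (x : 'cV[R]_(r + s)) :
  L21 A *m usubmx x + L22 A *m dsubmx x = dsubmx A *m (A^T *m x).
Proof. by rewrite mul_trmx_usub_dsub mulmxDr !mulmxA. Qed.

(** If [L22 v = 0] then [A^T] kills the vector [(0, v)], which must then be
constant; it has a zero entry because [0 < r]. *)
Lemma L22_unit : L22 A \in unitmx.
Proof.
rewrite -row_free_unit; apply: inj_row_free => v /(congr1 trmx).
rewrite trmx_mul trmx0 /L22 trmx_mul trmxK => /gram_kernel Av.
have : A^T *m col_mx 0 v^T = 0.
  by rewrite mul_trmx_usub_dsub col_mxKu col_mxKd mulmx0 add0r.
move=> /A_kernel diag; apply/rowP => j; rewrite mxE.
have := diag (rshift r j) (lshift s (Ordinal r_gt0)).
by rewrite col_mxEd col_mxEu !mxE.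
Qed.

Lemma constraintP (x : 'cV[R]_(r + s)) :
  constraint_set A x <-> x = E *m usubmx x.
Proof.
rewrite mul_col_mx mul1mx /constraint_set /=; split=> [/esym/eqP|xE].
  rewrite addrC addr_eq0 => /eqP L22z.
  rewrite -{1}(vsubmxK x); congr col_mx.
  by rewrite mulNmx -mulmxA -mulmxN -L22z mulKmx // L22_unit.
by rewrite {2}xE col_mxKd mulNmx mulmxN !mulmxA mulmxV ?L22_unit // mul1mx subrr.
Qed.

Lemma constraint_const c : constraint_set A (const_mx c).
Proof. by rewrite /constraint_set /= mul_lower_laplacian A_const mulmx0. Qed.

Lemma lift_const c : E *m const_mx c = const_mx c :> 'cV_(r + s).
Proof.
have /constraintP cE := constraint_const c; rewrite [RHS]cE; congr (_ *m _).
by apply/colP => i; rewrite !mxE.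
Qed.

Lemma usub_lift y : usubmx (E *m y) = y :> 'cV_r.
Proof. by rewrite mul_col_mx col_mxKu mul1mx. Qed.

Lemma constraint_lift (y : 'cV[R]_r) : constraint_set A (E *m y).
Proof. by apply/constraintP; rewrite usub_lift. Qed.

Lemma dsub_trmx_lift : dsubmx A *m (A^T *m E) = 0.
Proof.
rewrite -[in A^T](vsubmxK A) tr_col_mx mul_row_col mulmx1 mulmxDr mulmxA.
by rewrite /elim_mx !mulmxN !mulmxA mulmxV ?L22_unit // mul1mx subrr.
Qed.

(** [S] equals [A1 A^T E], where [A1] is the upper block of [A].  In
[E^T A A^T E] the lower block of [A] contributes nothing, because the image of
[E] satisfies the constraint ([dsub_trmx_lift]). *)
Lemma reduced_laplacianE : S = (E^T *m A) *m (E^T *m A)^T.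
Proof.
have -> : S = usubmx A *m (A^T *m E).
  rewrite /S /L11 /L12 -!mulmxA -mulmxDr; congr (_ *m _).
  by rewrite -[in RHS](vsubmxK A) tr_col_mx mul_row_col mulmx1.
rewrite trmx_mul trmxK -[in E^T *m A](vsubmxK A) tr_col_mx mul_row_col.
by rewrite trmx1 mul1mx mulmxDl -!mulmxA dsub_trmx_lift mulmx0 addr0.
Qed.

Lemma reduced_laplacian_sym : S^T = S.
Proof. by rewrite reduced_laplacianE trmx_mul trmxK. Qed.

Lemma reduced_laplacian_psd (y : 'cV[R]_r) : 0 <= (y^T *m S *m y) 0 0.
Proof.
rewrite reduced_laplacianE !mulmxA -[_ *m y]mulmxA.
by rewrite (_ : _ *m _ = ((E^T *m A)^T *m y)^T *m ((E^T *m A)^T *m y)) ?dot_ge0 //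
  !trmx_mul !trmxK !mulmxA.
Qed.

(** By the factorization, [S y = 0] forces [A^T (E y) = 0], so the whole point
[E y] is constant. *)
Lemma reduced_laplacian_kernel (y : 'cV[R]_r) :
  S *m y = 0 -> diagonal_line y.
Proof.
rewrite reduced_laplacianE => /gram_kernel.
rewrite trmx_mul trmxK -mulmxA => /A_kernel diag i j.
by have := diag (lshift s i) (lshift s j); rewrite !mul_col_mx !col_mxEu !mul1mx.
Qed.

(** By symmetry of [S] the sum is the pairing of [y] with [S 1], and [S 1 = 0]
because [E 1 = 1]. *)
Lemma sum_reduced_laplacian (y : 'cV[R]_r) : \sum_i (S *m y) i 0 = 0.
Proof.
have -> : \sum_i (S *m y) i 0 = ((const_mx 1 : 'cV_r)^T *m (S *m y)) 0 0.
  by rewrite [RHS]mxE; apply: eq_bigr => i _; rewrite !mxE mul1r.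
have S1 : S *m const_mx 1 = 0 :> 'cV_r.
  rewrite reduced_laplacianE [(E^T *m A)^T]trmx_mul trmxK -!mulmxA.
  by rewrite lift_const A_const !mulmx0.
by rewrite mulmxA -reduced_laplacian_sym -trmx_mul S1 trmx0 mul0mx mxE.
Qed.

Lemma upper_laplacian_constraint (x : 'cV[R]_(r + s)) : constraint_set A x ->
  - (L11 A *m usubmx x) - L12 A *m dsubmx x = - (S *m usubmx x).
Proof.
move=> /constraintP xE; rewrite {2}xE mul_col_mx col_mxKd.
by rewrite mulmxDl opprD !mulmxA.
Qed.

Lemma equilibrium_diagonal (x : 'cV[R]_(r + s)) :
  equilibrium A x -> diagonal_line x.
Proof.
rewrite /equilibrium mul_upper_laplacian mul_lower_laplacian => -[A1x A2x]; apply: A_kernel.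
apply: gram_kernel; rewrite -mulmxA -[X in X *m _](vsubmxK A) mul_col_mx.
by rewrite A1x A2x col_mx0.
Qed.

Lemma equilibrium_const c : equilibrium A (const_mx c).
Proof. by rewrite /equilibrium mul_upper_laplacian mul_lower_laplacian A_const !mulmx0. Qed.

End Reduction.

(** * Derivatives relative to an interval *)

(** The relative derivative for real-valued functions; entries of a vector curve
and its squared norm are handled through it. *)
Definition scalar_derivative_in (R : realType) (J : interval R) (f : R -> R)
    (t v : R) : Prop :=
  (u - t)^-1 * (f u - f t) @[u --> within [set` J] t^'] --> v.

Section RelativeDerivative.
Variables (R : realType) (J : interval R).

Lemma coord_derivative_in p (f : R -> 'cV[R]_p) t v k :
  has_derivative_in J f t v ->
  scalar_derivative_in J (fun u => f u k 0) t (v k 0).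
Proof.
move=> /(cvg_comp _ (fun x : 'cV[R]_p => x k 0)).
move=> /(_ _ (@coord_continuous R p 1 k 0 v)).
rewrite /scalar_derivative_in; apply: cvg_trans.
by apply: near_eq_cvg; near=> u; rewrite /= !mxE.
Unshelve. all: by end_near. Qed.

Lemma has_derivative_inB p (f g : R -> 'cV[R]_p) t v w :
  has_derivative_in J f t v -> has_derivative_in J g t w ->
  has_derivative_in J (fun u => f u - g u) t (v - w).
Proof.
rewrite /has_derivative_in => df dg; apply: cvg_trans (cvgB df dg).
apply: near_eq_cvg; near=> u; rewrite !fctE -scalerBr; congr (_ *: _).
by rewrite !opprD !opprK addrACA.
Unshelve. all: by end_near. Qed.

Lemma has_derivative_in_sum p (I : Type) (l : seq I)
    (f : I -> R -> 'cV[R]_p) t (v : I -> 'cV[R]_p) :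
  (forall i, has_derivative_in J (f i) t (v i)) ->
  has_derivative_in J (fun u => \sum_(i <- l) f i u) t (\sum_(i <- l) v i).
Proof.
rewrite /has_derivative_in => df.
have dsum : \sum_(i <- l) ((u - t)^-1 *: (f i u - f i t))
    @[u --> within [set` J] t^'] --> \sum_(i <- l) v i.
  by apply: cvg_big => // -[x y]; exact: add_continuous.
apply: cvg_trans dsum; apply: near_eq_cvg; near=> u.
by rewrite -scaler_sumr sumrB.
Unshelve. all: by end_near. Qed.

Lemma scalar_derivative_inD (f g : R -> R) t v w :
  scalar_derivative_in J f t v -> scalar_derivative_in J g t w ->
  scalar_derivative_in J (fun u => f u + g u) t (v + w).
Proof.
rewrite /scalar_derivative_in => df dg; apply: cvg_trans (cvgD df dg).
by apply: near_eq_cvg; near=> u; rewrite !fctE; ring.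
Unshelve. all: by end_near. Qed.

Lemma scalar_derivative_in_sum (I : Type) (s : seq I) (f : I -> R -> R) t
    (v : I -> R) : (forall i, scalar_derivative_in J (f i) t (v i)) ->
  scalar_derivative_in J (fun u => \sum_(i <- s) f i u) t (\sum_(i <- s) v i).
Proof.
move=> df; elim: s => [|i s IHs].
  rewrite big_nil /scalar_derivative_in.
  under eq_fun do rewrite !big_nil subrr mulr0.
  exact: cvg_cst.
rewrite big_cons; under eq_fun do rewrite big_cons.
exact: scalar_derivative_inD.
Qed.

Lemma scalar_derivative_inN (f : R -> R) t v :
  scalar_derivative_in J f t v ->
  scalar_derivative_in J (fun u => - f u) t (- v).
Proof.
rewrite /scalar_derivative_in => df; apply: cvg_trans (cvgN df).
by apply: near_eq_cvg; near=> u; rewrite !fctE; ring.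
Unshelve. all: by end_near. Qed.

Lemma scalar_derivative_in_cvg (f : R -> R) t v :
  scalar_derivative_in J f t v -> f u @[u --> within [set` J] t^'] --> f t.
Proof.
rewrite /scalar_derivative_in => df.
have idt : u - t @[u --> within [set` J] t^'] --> t - t.
  apply: cvgB; last exact: cvg_cst.
  by apply: cvg_within_filter; exact: nbhs_dnbhs.
have ft : f t + (u - t) * ((u - t)^-1 * (f u - f t))
    @[u --> within [set` J] t^'] --> f t.
  rewrite -[X in _ --> X]addr0 -[X in _ + X](mul0r v) -(subrr t).
  exact: cvgD (cvg_cst (f t)) (cvgM idt df).
have ut : \forall u \near within [set` J] t^', u != t.
  by rewrite near_withinE; apply: filterS (nbhs_dnbhs_neq t).
apply: cvg_trans ft.
apply: near_eq_cvg; near=> u; rewrite mulVKf; first by rewrite addrC subrK.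
by rewrite subr_eq0; near: u.
Unshelve. all: by end_near. Qed.

Lemma scalar_derivative_in_sqr (f : R -> R) t v :
  scalar_derivative_in J f t v ->
  scalar_derivative_in J (fun u => f u ^+ 2) t (2 * f t * v).
Proof.
move=> df; have d2 : (f u + f t) * ((u - t)^-1 * (f u - f t))
    @[u --> within [set` J] t^'] --> 2 * f t * v.
  rewrite mulr_natl mulr2n.
  exact: cvgM (cvgD (scalar_derivative_in_cvg df) (cvg_cst (f t))) df.
apply: cvg_trans d2.
by apply: near_eq_cvg; near=> u; ring.
Unshelve. all: by end_near. Qed.

Lemma is_derive_derivative_in (f : R -> R) (t v : R) :
  is_derive t 1 f v -> scalar_derivative_in J f t v.
Proof.
move=> [df dfE]; rewrite /scalar_derivative_in; apply: cvg_within_filter.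
have : h^-1 *: (f (h *: 1 + t) - f t) @[h --> 0^'] --> v by rewrite -dfE.
move=> /cvgrPdist_lt dft; apply/cvgrPdist_lt => e e0.
move: (dft _ e0); rewrite /dnbhs !near_withinE => near_0.
suff : \forall u \near t, u != t -> `|v - (u - t)^-1 * (f u - f t)| < e by [].
rewrite (near_shift 0 t) /= subr0; move: near_0; apply: filterS => h /=.
rewrite [h *: 1]mulr1 addrK => near_h ht; apply: near_h.
by apply: contra ht => /eqP ->; rewrite add0r.
Qed.

Lemma exp_derivative_in p (a : R) (w : 'cV[R]_p) t :
  has_derivative_in J (fun u => expR (a * u) *: w) t ((a * expR (a * t)) *: w).
Proof.
have d : is_derive t 1 (fun u => expR (a * u)) (a * expR (a * t)).
  by apply: is_derive_eq; rewrite /= [_ *: 1]mulr1 mulrC.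
have dw : ((u - t)^-1 * (expR (a * u) - expR (a * t))) *: w
    @[u --> within [set` J] t^'] --> (a * expR (a * t)) *: w.
  exact: cvgZr_tmp (is_derive_derivative_in d).
rewrite /has_derivative_in; apply: cvg_trans dw.
by apply: near_eq_cvg; near=> u; rewrite -scalerA scalerBl.
Unshelve. all: by end_near. Qed.

(** At interior points of [[a, b]] the derivative relative to [J] is the
ordinary one, and at the end points it still gives continuity relative to
[[a, b]]; this is what the mean value theorem needs. *)
Lemma nonpositive_derivative_nonincreasing (f f' : R -> R) a b :
  (forall t, t \in J -> scalar_derivative_in J f t (f' t)) ->
  (forall t, t \in J -> f' t <= 0) ->
  a \in J -> b \in J -> a <= b -> f b <= f a.
Proof.
move=> df f'le0 aJ bJ; rewrite le_eqVlt => /predU1P[->//|ab].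
have abJ u : a <= u <= b -> u \in J by exact: (interval_is_interval aJ bJ).
have dfo x : x \in `]a, b[%R -> is_derive x 1 f (f' x).
  move=> xab; have /df : x \in J.
    by apply: abJ; move: xab; rewrite in_itv/= => /andP[/ltW-> /ltW->].
  move=> /cvgrPdist_lt dfx; suff: h^-1 *: (f (h *: 1 + x) - f x) @[h --> 0^'] --> f' x.
    by move=> d; apply: DeriveDef; [apply/cvg_ex; exists (f' x)|exact/cvg_lim].
  apply/cvgrPdist_lt => e e0; move: (dfx _ e0); rewrite /dnbhs !near_withinE.
  move=> near_x; have {near_x} : \forall u \near x,
      u != x -> u \in J -> `|f' x - (u - x)^-1 * (f u - f x)| < e by [].
  have : \forall u \near x, u \in J.
    have := near_in_itvoo xab; apply: filterS => u.
    by rewrite in_itv/= => /andP[/ltW au /ltW ub]; apply: abJ; rewrite au ub.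
  rewrite !(near_shift 0 x) /= !subr0; apply: filterS2 => h /= hJ near_h h0.
  by move: near_h; rewrite [h *: 1]mulr1 addrK; apply=> //; rewrite -subr_eq0 addrK.
have cf : {within `[a, b], continuous f}.
  apply/subspace_continuousP => x /=; rewrite in_itv/= => xab.
  have := scalar_derivative_in_cvg (df _ (abJ _ xab)).
  move=> /cvgrPdist_lt fx; apply/cvgrPdist_lt => e e0; move: (fx _ e0).
  rewrite !near_withinE; apply: filterS => u.
  have [->|ux] := eqVneq u x; first by rewrite subrr normr0.
  by move=> fux; rewrite /= in_itv/= => /abJ; exact: fux.
apply: (@ler0_derive1_le_cc R f a b) => //.
- by move=> x /dfo [].
- move=> x xab; rewrite derive1E (@derive_val _ _ _ _ _ _ _ (dfo x xab)).
  by apply: f'le0; apply: abJ; move: xab; rewrite in_itv/= => /andP[/ltW-> /ltW->].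
- by rewrite in_itv/= lexx ltW.
- by rewrite in_itv/= lexx ltW.
- exact: ltW.
Qed.

End RelativeDerivative.

(** * Linear flow of a positive semidefinite matrix *)

Section LinearFlow.
Variables (R : realType) (n : nat) (S : 'M[R]_n).

(** The curve [exp (- t S) y0], when [w] splits [y0] into eigenvectors of [S]
with eigenvalues [lam]. *)
Definition modal_flow (lam : 'I_n -> R) (w : 'I_n -> 'cV[R]_n) (t : R) :=
  \sum_i expR (- lam i * t) *: w i.

Lemma modal_flow_derivative (J : interval R) lam w t :
  (forall i, S *m w i = lam i *: w i) ->
  has_derivative_in J (modal_flow lam w) t (- (S *m modal_flow lam w t)).
Proof.
move=> eig; rewrite /modal_flow mulmx_sumr -sumrN.
under eq_bigr do rewrite -scalemxAr eig scalerA -scaleNr mulrC -mulNr.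
by apply: has_derivative_in_sum => i; exact: exp_derivative_in.
Qed.

Lemma modal_flow0 lam w : modal_flow lam w 0 = \sum_i w i.
Proof. by apply: eq_bigr => i _; rewrite mulr0 expR0 scale1r. Qed.

(** Energy argument: the difference [d] of two solutions satisfies
[(|d|^2)' = - 2 d^T S d <= 0], so [d] stays zero once it vanishes. *)
Lemma linear_flow_unique (J : interval R) (f g : R -> 'cV[R]_n) t0 t :
  (forall y : 'cV[R]_n, 0 <= (y^T *m S *m y) 0 0) ->
  (forall u, u \in J -> has_derivative_in J f u (- (S *m f u))) ->
  (forall u, u \in J -> has_derivative_in J g u (- (S *m g u))) ->
  t0 \in J -> t \in J -> t0 <= t -> f t0 = g t0 -> f t = g t.
Proof.
move=> psd df dg t0J tJ t0t fg0; pose d u := f u - g u.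
have dd u : u \in J -> has_derivative_in J d u (- (S *m d u)).
  by move=> uJ; rewrite mulmxBr opprD; apply: has_derivative_inB; auto.
apply/eqP; rewrite -subr_eq0; apply/eqP/dot_eq0/eqP.
rewrite eq_le dot_ge0 andbT.
have energyE u : (d u)^T *m d u = (\sum_k d u k 0 ^+ 2)%:M.
  by rewrite [LHS]mx11_scalar mxE; congr _%:M; apply: eq_bigr => k _; rewrite mxE.
have energy' u : u \in J -> scalar_derivative_in J (fun u => \sum_k d u k 0 ^+ 2) u
    (\sum_k 2 * d u k 0 * (- (S *m d u)) k 0).
  move=> uJ; apply: scalar_derivative_in_sum => k.
  apply: scalar_derivative_in_sqr; exact: coord_derivative_in (dd u uJ).
have : \sum_k d t k 0 ^+ 2 <= \sum_k d t0 k 0 ^+ 2.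
  apply: (nonpositive_derivative_nonincreasing energy') => // u _.
  rewrite (_ : \sum_k _ = - 2 * ((d u)^T *m S *m d u) 0 0).
    by rewrite mulNr oppr_le0 mulr_ge0.
  rewrite -mulmxA mxE mulr_sumr; apply: eq_bigr => k _.
  by rewrite !mxE mulrN -mulrA !mulNr.
rewrite -/(d t) energyE mxE eqxx mulr1n => /le_trans; apply.
by rewrite big1 // => k _; rewrite /d fg0 subrr mxE expr0n.
Qed.

Lemma positive_rates_bounded_below (I : finType) (lam : I -> R) :
  exists2 a, 0 < a & forall i, 0 < lam i -> a <= lam i.
Proof.
(* The initial value 1 covers the case where no rate is positive. *)
exists (\big[Order.min/1]_(i | 0 < lam i) lam i).
  by elim/big_ind: _ => // x y x0 y0; rewrite lt_min x0.
by move=> i li; rewrite (bigD1 i) //= ge_min lexx.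
Qed.

End LinearFlow.

Section Modes.
Variables (R : realType) (n : nat) (S : 'M[R]_n).
Hypothesis S_psd : forall y : 'cV[R]_n, 0 <= (y^T *m S *m y) 0 0.
Hypothesis S_kernel : forall y : 'cV[R]_n, S *m y = 0 -> diagonal_line y.
Hypothesis S_sum : forall y : 'cV[R]_n, \sum_i (S *m y) i 0 = 0.
Variables (lam : 'I_n -> R) (w : 'I_n -> 'cV[R]_n).
Hypothesis eig : forall i, S *m w i = lam i *: w i.

Lemma psd_eigenvalue_ge0 i : w i != 0 -> 0 <= lam i.
Proof.
move=> w0; have := S_psd (w i); rewrite -mulmxA eig -scalemxAr mxE.
rewrite pmulr_lge0 // lt_def dot_ge0 andbT; apply: contra w0 => /eqP.
by move=> /dot_eq0 ->.
Qed.

(** A mode with [lam i != 0] is [S] applied to a multiple of itself, so its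
coordinates sum to zero; the null modes together carry the whole coordinate sum
and form a constant vector. *)
Lemma null_modes_sum : (0 < n)%N ->
  \sum_(i | lam i == 0) w i = const_mx ((\sum_k (\sum_i w i) k 0) / n%:R).
Proof.
move=> n0; set v := \sum_(i | lam i == 0) w i.
have sumv : \sum_k (\sum_i w i) k 0 = \sum_k v k 0.
  under eq_bigr do rewrite summxE; rewrite exchange_big /=.
  under [RHS]eq_bigr do rewrite summxE; rewrite [RHS]exchange_big /=.
  rewrite (bigID (fun i => lam i == 0)) /= [X in _ + X]big1 ?addr0 // => i li.
  have : \sum_k lam i * w i k 0 = 0.
    by rewrite -[RHS](S_sum (w i)) eig; apply: eq_bigr => k _; rewrite mxE.
  by rewrite -mulr_sumr => /eqP; rewrite mulf_eq0 (negPf li) => /eqP.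
have /S_kernel diag : S *m v = 0.
  by rewrite mulmx_sumr big1 // => i /eqP li; rewrite eig li scale0r.
apply/colP => k; rewrite mxE sumv (eq_bigr (fun=> v k 0)) => [|j _]; last exact: diag.
by rewrite sumr_const card_ord -[_ *+ n]mulr_natr mulfK // pnatr_eq0 -lt0n.
Qed.

(** Stated after applying a matrix [E] so that the bound transfers directly
from [y] to the full state [(y, z)]. *)
Lemma modal_flow_decay p (E : 'M[R]_(p, n)) :
  exists M a : R, 0 < a /\ forall t, 0 <= t ->
    `|E *m modal_flow lam w t - E *m \sum_(i | lam i == 0) w i|
      <= M * expR (- (a * t)).
Proof.
have [a a0 alam] := positive_rates_bounded_below lam.
exists (\sum_i `|E *m w i|), a; split=> // t t0.
rewrite -mulmxBr /modal_flow (bigID (fun i => lam i == 0)) /=.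
rewrite [X in X + _ - _](eq_bigr w) => [|i /eqP ->]; last first.
  by rewrite oppr0 mul0r expR0 scale1r.
rewrite addrAC subrr add0r mulmx_sumr (le_trans (ler_norm_sum _ _ _)) // mulr_suml.
rewrite [leRHS](bigID (fun i => lam i == 0)) /=; apply: ler_wpDl.
  by apply: sumr_ge0 => i _; rewrite mulr_ge0 // expR_ge0.
apply: ler_sum => i li; rewrite -scalemxAr normrZ ger0_norm ?expR_ge0 // mulrC.
have [->|w0] := eqVneq (w i) 0; first by rewrite mulmx0 normr0 !mul0r.
rewrite ler_wpM2l // ler_expR mulNr lerN2 ler_wpM2r // alam //.
by rewrite lt_def li psd_eigenvalue_ge0.
Qed.

End Modes.

(** * Solutions of the differential-algebraic equation *)

Section Dynamics.
Variables (R : realType) (r s m : nat) (A : 'M[R]_(r + s, m)).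
Hypothesis r_gt0 : (0 < r)%N.
Hypothesis A_const : forall c : R, A^T *m const_mx c = 0 :> 'cV_m.
Hypothesis A_kernel : forall x : 'cV[R]_(r + s), A^T *m x = 0 -> diagonal_line x.
Local Notation E := (lift_mx A).
Local Notation S := (reduced_laplacian A).

(** On the constraint set the equation is the linear flow of [S] in the
variable [y], and the full state is recovered by [lift_mx]. *)
Lemma dae_solutionP (J : interval R) (x : R -> 'cV[R]_(r + s)) :
  dae_solution A J x <-> forall t, t \in J ->
    has_derivative_in J (fun u => usubmx (x u)) t (- (S *m usubmx (x t))) /\
    x t = E *m usubmx (x t).
Proof.
split=> sol t tJ.
  have [dy cx] := sol t tJ; split; last exact/(constraintP r_gt0 A_kernel).
  by rewrite -(upper_laplacian_constraint r_gt0 A_kernel).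
have [dy /(constraintP r_gt0 A_kernel) cx] := sol t tJ; split=> //.
by rewrite (upper_laplacian_constraint r_gt0 A_kernel).
Qed.

Lemma dae_solution_lift (J : interval R) (y : R -> 'cV[R]_r) :
  (forall t, t \in J -> has_derivative_in J y t (- (S *m y t))) ->
  dae_solution A J (fun t => E *m y t).
Proof.
move=> dy; apply/dae_solutionP => t tJ; rewrite usub_lift; split=> //.
by under eq_fun do rewrite usub_lift; exact: dy.
Qed.

Lemma dae_solution_unique (J : interval R) (x x' : R -> 'cV[R]_(r + s)) t0 t :
  dae_solution A J x -> dae_solution A J x' ->
  t0 \in J -> t \in J -> t0 <= t -> x t0 = x' t0 -> x t = x' t.
Proof.
move=> /dae_solutionP sx /dae_solutionP sx' t0J tJ t0t x0.
have [_ ->] := sx t tJ; have [_ ->] := sx' t tJ; congr (_ *m _).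
apply: (@linear_flow_unique _ _ S J (usubmx \o x) (usubmx \o x') t0 t) => //=.
- exact: reduced_laplacian_psd.
- by move=> u /sx[].
- by move=> u /sx'[].
- by rewrite x0.
Qed.

(** The derivative of the sum is the coordinate sum of [- S y], hence zero. *)
Lemma dae_sum_constant (J : interval R) (x : R -> 'cV[R]_(r + s)) t0 t :
  dae_solution A J x -> t0 \in J -> t \in J -> t0 <= t ->
  \sum_(i < r) usubmx (x t) i 0 = \sum_(i < r) usubmx (x t0) i 0.
Proof.
move=> /dae_solutionP sx t0J tJ t0t.
pose sum_y u := \sum_(i < r) usubmx (x u) i 0.
have dsum u : u \in J -> scalar_derivative_in J sum_y u 0.
  move=> /sx[dy _].
  rewrite (_ : 0 = \sum_i (- (S *m usubmx (x u))) i 0).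
    by apply: scalar_derivative_in_sum => i; exact: coord_derivative_in dy.
  under eq_bigr do rewrite mxE.
  by rewrite sumrN (sum_reduced_laplacian r_gt0 A_const A_kernel) oppr0.
have le1 : sum_y t <= sum_y t0.
  exact: (nonpositive_derivative_nonincreasing (f' := fun=> 0) dsum).
have le2 : - sum_y t <= - sum_y t0.
  apply: (nonpositive_derivative_nonincreasing (f' := fun=> - 0)
    (fun u uJ => scalar_derivative_inN (dsum u uJ))) => //=.
by apply/eqP; rewrite eq_le le1 -lerN2.
Qed.

Lemma solution_exists (p : 'cV[R]_(r + s)) : constraint_set A p ->
  exists x : R -> 'cV[R]_(r + s),
    [/\ forall J : interval R, dae_solution A J x, x 0 = p &
      converges_exponentially x
        (const_mx ((\sum_(i < r) usubmx p i 0) / r%:R))].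
Proof.
move=> /(constraintP r_gt0 A_kernel) pE.
have symS := reduced_laplacian_sym r_gt0 A_kernel.
have [lam [w [eig yE]]] := symmetric_eigenvector_sum (usubmx p) symS.
exists (fun t => E *m modal_flow lam w t); split.
- by move=> J; apply: dae_solution_lift => t _; exact: modal_flow_derivative.
- by rewrite modal_flow0 -yE -pE.
have psd := reduced_laplacian_psd r_gt0 A_kernel.
rewrite -(lift_const r_gt0 A_const A_kernel) yE.
rewrite -(null_modes_sum (reduced_laplacian_kernel r_gt0 A_kernel)
  (sum_reduced_laplacian r_gt0 A_const A_kernel) eig r_gt0).
exact: modal_flow_decay.
Qed.

End Dynamics.

(** * Dimensions and transversality *)

Lemma affine_spaceP (R : realType) (V : vectType R) (S : set V)
    (U : {vspace V}) p :
  S p -> (forall x, S x <-> x - p \in U) -> affine_space S U.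
Proof.
move=> Sp SU; exists p => //; apply/seteqP; split=> [x /SU xp|_ [u uU <-]].
  by exists (x - p) => //; rewrite addrC subrK.
by apply/SU; rewrite addrC addKr.
Qed.

Section Spaces.
Variables (R : realType) (r s m : nat) (A : 'M[R]_(r + s, m)).
Hypothesis r_gt0 : (0 < r)%N.
Hypothesis A_const : forall c : R, A^T *m const_mx c = 0 :> 'cV_m.
Hypothesis A_kernel : forall x : 'cV[R]_(r + s), A^T *m x = 0 -> diagonal_line x.
Local Notation V := 'cV[R]_(r + s).
Local Notation ones := (const_mx 1 : 'cV[R]_(r + s)).

Definition constraint_space : {vspace V} := limg (linfun (mulmx (lift_mx A))).

(** [y_1 + ... + y_r] as a linear map, with values in the 1 x 1 matrices so that
kernel and rank theory for linear maps applies. *)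
Definition sum_form : 'Hom(V, 'M[R]_1) :=
  linfun (mulmx (row_mx (const_mx 1) 0)).

(** The common direction of the invariant leaves. *)
Definition leaf_space : {vspace V} := (constraint_space :&: lker sum_form)%VS.

Lemma mem_constraint_space x :
  reflect (constraint_set A x) (x \in constraint_space).
Proof.
apply: (iffP memv_imgP) => [[y _ ->]|]; first by rewrite lfunE; exact: constraint_lift.
move=> /(constraintP r_gt0 A_kernel) xE; exists (usubmx x); first exact: memvf.
by rewrite lfunE.
Qed.

Lemma sum_formE x : sum_form x = (\sum_(i < r) usubmx x i 0)%:M.
Proof.
rewrite lfunE /= -{1}(vsubmxK x) mul_row_col mul0mx addr0 [LHS]mx11_scalar mxE.
by congr _%:M; apply: eq_bigr => i _; rewrite !mxE mul1r.
Qed.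

Lemma mem_sum_kernel x :
  (x \in lker sum_form) = (\sum_(i < r) usubmx x i 0 == 0).
Proof.
rewrite memv_ker sum_formE; apply/eqP/eqP => [/matrixP/(_ 0 0)|->].
  by rewrite !mxE.
by rewrite raddf0.
Qed.

Lemma sum_const c :
  \sum_(i < r) usubmx (const_mx c : V) i 0 = r%:R * c.
Proof.
under eq_bigr do rewrite !mxE.
by rewrite sumr_const card_ord mulr_natl.
Qed.

Lemma r_neq0 : r%:R != 0 :> R.
Proof. by rewrite pnatr_eq0 -lt0n. Qed.

Lemma sum_const_div k :
  \sum_(i < r) usubmx (const_mx (k / r%:R) : V) i 0 = k.
Proof. by rewrite sum_const mulrC divfK // r_neq0. Qed.

Lemma dim_constraint_space : \dim constraint_space = r.
Proof.
rewrite /constraint_space limg_dim_eq; first exact: etrans (dimvf _) (muln1 r).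
rewrite capfv; apply/eqP/lker0P => y1 y2; rewrite !lfunE /= => /(congr1 usubmx).
by rewrite !usub_lift.
Qed.

(** The coordinate sum is onto on the constraint space, since it does not vanish
at the vector of ones; its kernel there has one dimension less. *)
Lemma dim_leaf_space : \dim leaf_space = (r - 1)%N.
Proof.
suff dim_img : \dim (sum_form @: constraint_space)%VS = 1%N.
  have := limg_ker_dim sum_form constraint_space.
  by rewrite dim_img dim_constraint_space => /(canRL (addnK 1%N)).
apply/eqP; rewrite eqn_leq; apply/andP; split.
  exact: leq_trans (dimvS (subvf _)) (eq_leq (dimvf _)).
rewrite lt0n dimv_eq0; apply/eqP => img0.
have : sum_form ones \in (sum_form @: constraint_space)%VS.
  by apply: memv_img; apply/mem_constraint_space; exact: constraint_const.
rewrite img0 memv0 -memv_ker mem_sum_kernel sum_const mulr1.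
by rewrite (negPf r_neq0).
Qed.

Lemma constraint_affine : affine_space (constraint_set A) constraint_space.
Proof.
have c0 : constraint_set A 0 by apply/mem_constraint_space; exact: mem0v.
apply: (affine_spaceP c0) => x; rewrite subr0.
by split=> /mem_constraint_space.
Qed.

Lemma hyperplane_affine k :
  affine_space (@sum_hyperplane R r s k) (lker sum_form).
Proof.
apply: (affine_spaceP (sum_const_div k)) => x.
rewrite memv_ker raddfB /= subr_eq0 !sum_formE sum_const_div.
split=> [->//|/eqP/matrixP/(_ 0 0)]; by rewrite !mxE !mulr1n.
Qed.

Lemma leaf_affine k :
  affine_space (constraint_set A `&` @sum_hyperplane R r s k) leaf_space.
Proof.
have cp := constraint_const A_const (k / r%:R).
apply: (@affine_spaceP _ _ _ _ (const_mx (k / r%:R))) => [|x].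
  by split=> //; exact: sum_const_div.
rewrite memv_cap memv_ker raddfB /= subr_eq0 !sum_formE sum_const_div.
rewrite rpredBr; last exact/mem_constraint_space.
split=> [[/mem_constraint_space -> ->]|/andP[/mem_constraint_space cx]] //=.
by move=> /eqP/matrixP/(_ 0 0); rewrite !mxE !mulr1n.
Qed.

Lemma diagonal_affine : affine_space (@diagonal_line R (r + s)) <[ones]>.
Proof.
apply: (@affine_spaceP _ _ _ _ 0) => [i j|x]; first by rewrite !mxE.
rewrite subr0; split=> [diag|/vlineP[c ->] i j]; last by rewrite !mxE.
apply/vlineP; exists (x (lshift s (Ordinal r_gt0)) 0).
by apply/colP => i; rewrite !mxE mulr1; exact: diag.
Qed.

(** Subtracting the mean of the first [r] coordinates from every coordinate of
[x] is the projection along the line of constants behind both transversality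
statements. *)
Lemma sub_mean_sum (x : V) :
  x - ((\sum_(i < r) usubmx x i 0) / r%:R) *: ones \in lker sum_form.
Proof.
rewrite memv_ker raddfB /= linearZ /= !sum_formE sum_const mulr1 subr_eq0.
by rewrite scale_scalar_mx divfK ?r_neq0.
Qed.

Lemma ones_in_constraint_space : ones \in constraint_space.
Proof. by apply/mem_constraint_space; exact: constraint_const. Qed.

Lemma constraint_add_hyperplane : (constraint_space + lker sum_form)%VS = fullv.
Proof.
apply/eqP; rewrite eqEsubv subvf; apply/subvP => x _.
rewrite -[x](subrK (((\sum_(i < r) usubmx x i 0) / r%:R) *: ones)) addrC.
by rewrite memv_add ?sub_mean_sum // rpredZ ?ones_in_constraint_space.
Qed.

Lemma line_add_leaf : (<[ones]> + leaf_space)%VS = constraint_space.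
Proof.
apply/eqP; rewrite eqEsubv; apply/andP; split.
  by rewrite subv_add capvSl andbT -memvE ones_in_constraint_space.
apply/subvP => x xU.
rewrite -[x](subrK (((\sum_(i < r) usubmx x i 0) / r%:R) *: ones)) addrC.
rewrite memv_add ?rpredZ ?memv_line // memv_cap sub_mean_sum andbT.
by rewrite rpredB // rpredZ // ones_in_constraint_space.
Qed.

Lemma leaves_foliation :
  affine_foliation (r - 1) (constraint_set A)
    (fun k : R => constraint_set A `&` @sum_hyperplane R r s k).
Proof.
exists leaf_space; split.
- exact: dim_leaf_space.
- by move=> k; exact: leaf_affine.
- apply/seteqP; split=> [x [k _ []//]|x cx].
  by exists (\sum_(i < r) usubmx x i 0).
- by move=> k l _ _ [x [[_ <-] [_ <-]]].
Qed.

End Spaces.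

(** * Foliation by invariant spaces and exponential convergence *)

Theorem theorem1 (R : realType) (r s m : nat) (hr : (1 <= r)%N) (hs : (1 <= s)%N)
    (G : directed_graph (r + s) m) (hsimple : simple_graph G)
    (hconn : connected_graph G)
    (A : 'M[R]_(r + s, m)) (hA : A = incidence_mx R G) :
  (* (a) *)
  ((linear_space_of_dim r (constraint_set A) /\
    filled_by_solutions A (constraint_set A)) /\
   (forall k : R,
      transversal_in setT (constraint_set A) (@sum_hyperplane R r s k)) /\
   affine_foliation (r - 1) (constraint_set A)
     (fun k : R => constraint_set A `&` @sum_hyperplane R r s k) /\
   (forall k : R, invariant_set A (constraint_set A `&` @sum_hyperplane R r s k)))
  /\
  (* (b) *)
  ((forall x : 'cV[R]_(r + s), equilibrium A x -> diagonal_line x) /\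
   ((2 <= r)%N -> forall k : R,
      transversal_in (constraint_set A) (@diagonal_line R (r + s))
        (constraint_set A `&` @sum_hyperplane R r s k)))
  /\
  (* (c) *)
  (forall (y0 : 'cV[R]_r) (z0 : 'cV[R]_s),
     constraint_set A (col_mx y0 z0) ->
     let e : 'cV[R]_(r + s) := const_mx ((\sum_(i < r) y0 i 0) / r%:R) in
     equilibrium A e /\
     exists x : R -> 'cV[R]_(r + s),
       trajectory_from A (col_mx y0 z0) x /\ converges_exponentially x e).
Proof.
have A_const c : A^T *m const_mx c = 0 :> 'cV_m.
  by rewrite hA incidence_tr_const //; case: hsimple.
have A_kernel (x : 'cV[R]_(r + s)) : A^T *m x = 0 -> diagonal_line x.
  by rewrite hA; apply: incidence_tr_kernel => //; case: hsimple.
split; [split; [split|split; [|split]]|split; [split|]].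
- exists (constraint_space A); split; last exact: dim_constraint_space.
  by apply/seteqP; split=> x /(mem_constraint_space hr A_kernel).
- move=> p; split=> [/(solution_exists hr A_const A_kernel)[x [sol xp _]]|].
    by exists x.
  by move=> [x [sol <-]]; have [] := sol 0 isT.
- move=> k; exists fullv, (constraint_space A), (lker (sum_form R r s)).
  split; split=> //.
  + by apply: (@affine_spaceP _ _ setT fullv 0) => // x; split=> // _; exact: memvf.
  + exact: constraint_affine.
  + exact: hyperplane_affine.
  + exact: constraint_add_hyperplane.
- exact: leaves_foliation.
- move=> k J x sol t0 t t0J tJ t0t [_ xk]; split; first by have [] := sol t tJ.
  by rewrite /sum_hyperplane /= (dae_sum_constant hr A_const A_kernel sol t0J).
- by move=> x; exact: equilibrium_diagonal.
- move=> _ k; exists (constraint_space A), <[const_mx 1]>%VS, (leaf_space A).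
  split; split.
  + exact: constraint_affine.
  + exact: diagonal_affine.
  + exact: leaf_affine.
  + move=> x diag; rewrite (_ : x = const_mx (x (lshift s (Ordinal hr)) 0)).
      exact: constraint_const.
    by apply/colP => i; rewrite mxE; exact: diag.
  + by move=> x [].
  + exact: line_add_leaf.
- move=> y0 z0 c0 e; split; first exact: equilibrium_const.
  have [x [sol x0 xe]] := solution_exists hr A_const A_kernel c0.
  exists x; split; last by move: xe; rewrite col_mxKu.
  split=> // J w solw J0 w0 t tJ t0.
  by apply: (dae_solution_unique hr A_kernel solw (sol J) J0 tJ t0); rewrite w0.
Qed.
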